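(* For every cardinal number $\kappa$, $\Theta(\kappa)$ is a normal subgroup of $O(\kappa)$, i.e. $\Theta(\kappa) \trianglelefteq O(\kappa)$, where both groups are formed from the same real Hilbert space $\mathcal{H}$ of Hilbert dimension $\kappa$.
   Context: Let $\mathcal{H}$ be a real Hilbert space of Hilbert dimension $\kappa$ and $\mathscr{B}(\mathcal{H})$ the bounded linear operators on it. An operator $L\in\mathscr{B}(\mathcal{H})$ is a reflection operator if there is an orthonormal set $\{e_\alpha\}_{\alpha\in\mathfrak{A}}$ in $\mathcal{H}$ (of any cardinality, possibly empty) such that $L=2P-I$, where $P x=\sum_{\alpha\in\mathfrak{A}}\langle x,e_\alpha\rangle e_\alpha$. Let $\mathrm{Refl}(\mathcal{H})$ be the set of reflection operators on $\mathcal{H}$. $\Theta(\kappa)$ is the set of all $A\in\mathscr{B}(\mathcal{H})$ that are products $A=\prod_{j=1}^{m}L_j$ of finitely many elements $L_j\in\mathrm{Refl}(\mathcal{H})$, with operator composition. $O(\kappa)=\mathrm{Aut}(\mathcal{H})$ is the group, under composition, of all bijective linear maps $\sigma:\mathcal{H}\to\mathcal{H}$ with $\langle\sigma x,\sigma y\rangle=\langle x,y\rangle$ for all $x,y\in\mathcal{H}$. *)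

(* Defs.v *)
From HB Require Import structures.
From mathcomp Require Import all_boot all_order all_algebra finmap.
From mathcomp Require Import boolp classical_sets functions reals.
From mathcomp Require Import topology normedtype.
From mathcomp.analysis Require Import showcase.summability.

Set Implicit Arguments.
Unset Strict Implicit.
Unset Printing Implicit Defensive.

Import Order.TTheory GRing.Theory Num.Theory.
Import numFieldNormedType.Exports.

Local Open Scope classical_set_scope.
Local Open Scope ring_scope.

Record hilbertSpace (R : realType) := HilbertSpace {
  hilbert_sort :> completeNormedModType R;
  inner : {dot hilbert_sort for idfun};
  inner_norm : forall x : hilbert_sort, `|x| ^+ 2 = inner x x
}.

Definition orthonormal_family {R : realType} (H : hilbertSpace R) (I : Type)
    (e : I -> H) : Prop :=
  (forall a, inner H (e a) (e a) = 1) /\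
  (forall a b, a <> b -> inner H (e a) (e b) = 0).

(* An orthonormal basis is an orthonormal family whose linear span is dense.
   A cardinal is represented by a type of that cardinality; boolp makes any
   type T a choiceType, namely {classic T}. *)
Definition has_hilbert_dim {R : realType} (H : hilbertSpace R)
    (K : choiceType) : Prop :=
  exists2 e : K -> H, orthonormal_family e &
    closure [set v : H | exists (c : K -> R) (J : {fset K}),
      v = partial_sum (fun a => c a *: e a) J] = setT.

(* `sum` is the unconditional sum, i.e. the limit of the finite partial sums
   along the directed set {fset I}; it is convergent here, see orth_proj_cvg. *)
Definition orth_proj {R : realType} (H : hilbertSpace R) (I : choiceType)
    (e : I -> H) (x : H) : H :=
  sum (fun a => inner H x (e a) *: e a).

Section OrthProj.
Variables (R : realType) (H : hilbertSpace R) (I : choiceType) (e : I -> H).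
Hypothesis e_on : orthonormal_family e.
Variable x : H.

Let p := partial_sum (fun a => inner H x (e a) *: e a).
Let q (J : {fset I}) : R := \sum_(a <- J) inner H x (e a) ^+ 2.

Lemma inner_sym (y z : H) : inner H y z = inner H z y.
Proof. by rewrite hermitian_subproof expr0 mul1r. Qed.

Let innerZr a (y z : H) : inner H y (a *: z) = a * inner H y z.
Proof. by rewrite inner_sym linearZl_LR inner_sym. Qed.

Let pE J : p J = \sum_(a <- J) inner H x (e a) *: e a.
Proof. by rewrite /p /partial_sum big_seq_fsetE. Qed.

Let inner_xp J : inner H x (p J) = q J.
Proof.
by rewrite pE raddf_sum; apply: eq_bigr => a _ /=; rewrite innerZr.
Qed.

Let inner_pe J a : a \in J -> inner H (p J) (e a) = inner H x (e a).
Proof.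
move=> aJ; rewrite inner_sym pE raddf_sum (big_fsetD1 a)//= innerZr e_on.1 mulr1 big1_seq ?addr0// => b.
rewrite !inE => /andP[_ /andP[ba _]]; rewrite innerZr e_on.2 ?mulr0//.
by move=> ab; rewrite ab eqxx in ba.
Qed.

Let inner_pp J K : {subset K <= J} -> inner H (p J) (p K) = q K.
Proof.
move=> KJ; rewrite [in p K]pE raddf_sum /q !big_seq; apply: eq_bigr => a aK.
by rewrite /= innerZr inner_pe ?KJ.
Qed.

Let normB_sqr (y z : H) :
  `|y - z| ^+ 2 = inner H y y - inner H y z *+ 2 + inner H z z.
Proof.
rewrite inner_norm linearBl !raddfB/= (inner_sym z y) mulr2n.
by rewrite opprD opprK !addrA.
Qed.

Let bessel J : q J <= `|x| ^+ 2.
Proof.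
rewrite -subr_ge0; have := normB_sqr x (p J).
rewrite inner_xp inner_pp// (inner_norm x) mulr2n opprD addrA subrK => <-.
exact: sqr_ge0.
Qed.

Let normBp J K : {subset K <= J} -> `|p K - p J| ^+ 2 = q J - q K.
Proof.
by move=> KJ; rewrite distrC normB_sqr !inner_pp// mulr2n opprD addrA subrK.
Qed.

Lemma orth_proj_cvg : p @ totally --> orth_proj e x.
Proof.
have tF : ProperFilter (@totally I) by exact: totally_filter.
suff : cvg (p @ totally) by [].
apply: cauchy_cvg; apply/cauchyP => eps eps0.
have hs : has_sup (range q).
  by split; [exists (q fset0), fset0|exists (`|x| ^+ 2) => _ [J _ <-]].
have [_ [K _ <-] supK] := sup_adherent (exprn_gt0 2 eps0) hs.
exists (p K); exists K => // J /= /fsubsetP KJ.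
rewrite -ball_normE /ball_ /= -(@ltr_pXn2r _ 2)// ?nnegrE ?(ltW eps0)//.
rewrite normBp// ltrBlDl -ltrBlDr (le_lt_trans _ supK)// lerD2r.
by apply: (sup_upper_bound hs); exists J.
Qed.

End OrthProj.

Section Operators.
Variables (R : realType) (H : hilbertSpace R).

Definition bounded_operators : set (H -> H) :=
  [set A | linear A /\ exists M : R, forall x, `|A x| <= M * `|x|].

Definition Refl : set (H -> H) :=
  [set L | bounded_operators L /\
    exists (I : choiceType) (e : I -> H), orthonormal_family e /\
      forall x, L x = 2 *: orth_proj e x - x].

(* Empty products are allowed; this does not change the set, as the identity is
   already (- I) \o (- I), with - I the reflection given by the empty family. *)
Definition Theta : set (H -> H) :=
  [set A | bounded_operators A /\
    exists (m : nat) (L : 'I_m -> H -> H),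
      (forall j, Refl (L j)) /\ A = \big[@comp H H H/idfun]_(j < m) L j].

Definition orthogonal_maps : set (H -> H) :=
  [set s | [/\ linear s, bijective s &
    forall x y, inner H (s x) (s y) = inner H x y]].

Lemma orthogonal_maps_id : orthogonal_maps idfun.
Proof. by split=> //; exists idfun. Qed.

Lemma orthogonal_maps_comp (s t : H -> H) :
  orthogonal_maps s -> orthogonal_maps t -> orthogonal_maps (s \o t).
Proof.
move=> [ls bs is_] [lt bt it]; split; last 1 first.
- by move=> x y /=; rewrite is_ it.
- by move=> a x y /=; rewrite lt ls.
- exact: bij_comp.
Qed.

Lemma orthogonal_maps_inv (s : H -> H) : orthogonal_maps s ->
  exists t, [/\ orthogonal_maps t, cancel s t & cancel t s].
Proof.
move=> [ls [t st ts] is_]; exists t; split=> //; split.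
- by move=> a x y; apply: (can_inj st); rewrite ls !ts.
- by exists s.
- by move=> x y; rewrite -is_ !ts.
Qed.

Definition orthogonal_group : Type := set_type orthogonal_maps.

HB.instance Definition _ := Choice.on orthogonal_group.

Implicit Types s t : orthogonal_group.

Lemma orthogonal_groupP s : orthogonal_maps (val s).
Proof. exact: set_mem (valP s). Qed.

Definition ogroup_one : orthogonal_group := SigSub (mem_set orthogonal_maps_id).

Definition ogroup_mul s t : orthogonal_group :=
  SigSub (mem_set (orthogonal_maps_comp (orthogonal_groupP s)
                                        (orthogonal_groupP t))).

Definition ogroup_inv s : orthogonal_group :=
  let t := cid (orthogonal_maps_inv (orthogonal_groupP s)) in
  SigSub (mem_set (let: And3 tO _ _ := projT2 t in tO)).

Lemma ogroup_invK s :
  cancel (val s) (val (ogroup_inv s)) /\ cancel (val (ogroup_inv s)) (val s).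
Proof. by rewrite /ogroup_inv /=; case: cid => t []. Qed.

Let mulA : associative ogroup_mul.
Proof. by move=> s t u; apply: val_inj. Qed.

Let mul1 : left_id ogroup_one ogroup_mul.
Proof. by move=> s; apply: val_inj. Qed.

Let mulr1 : right_id ogroup_one ogroup_mul.
Proof. by move=> s; apply: val_inj. Qed.

Let mulV : left_inverse ogroup_one ogroup_inv ogroup_mul.
Proof.
by move=> s; apply: val_inj; apply/funext => x /=; exact: (ogroup_invK s).1.
Qed.

Let mulrV : right_inverse ogroup_one ogroup_inv ogroup_mul.
Proof.
by move=> s; apply: val_inj; apply/funext => x /=; exact: (ogroup_invK s).2.
Qed.

HB.instance Definition _ :=
  isGroup.Build orthogonal_group mulA mul1 mulr1 mulV mulrV.

End Operators.

Arguments bounded_operators {R} H.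
Arguments Refl {R} H.
Arguments Theta {R} H.
Arguments orthogonal_maps {R} H.

Definition normal_subgroup (G : groupType) (N : set G) : Prop :=
  group_closed [in N] /\ forall x y : G, N x -> N (x ^ y)%g.

(* Main.v *)
Require Import Defs.
From mathcomp Require Import all_boot all_order all_algebra finmap.
From mathcomp Require Import boolp classical_sets functions reals.
From mathcomp Require Import topology normedtype.
From mathcomp Require Import ring.
From mathcomp.analysis Require Import showcase.summability.
Import Order.TTheory GRing.Theory Num.Theory.
Import numFieldNormedType.Exports.
Local Open Scope classical_set_scope.
Local Open Scope ring_scope.

(** Every reflection operator is an orthogonal involution, and a conjugate of a
reflection operator by an orthogonal map is again one; the theorem follows
formally by induction on the number of factors of a product.

Let [L = 2 P - I], where [P] is the projection attached to an orthonormal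
family [e].  Convergent nets pass through the inner product
([cvg_inner]), so the finite partial sums show that [P] is symmetric and that
[P x] has the same coefficients along [e] as [x].  Hence so has
[L x = 2 P x - x], and since [P] depends only on these coefficients,
[P (L x) = P x] and [L (L x) = 2 P x - (2 P x - x) = x]
([reflection_involutive]).  A symmetric involution preserves the inner product:
[<L x, L y> = <x, L (L y)> = <x, y>].

The inverse of [L_1 ... L_m] is therefore the product [L_m ... L_1]
([Theta_inverse]), which makes [Theta] a subgroup.  If [s] is orthogonal with
inverse [t], then [s P t] is the projection attached to the orthonormal family
[s \o e] ([orth_proj_conj]), so [s L t] is a reflection operator, and a
conjugate of a product is the product of the conjugates. *)

(** * Continuity of the inner product *)

Lemma innerDl (R : realType) (H : hilbertSpace R) (x y z : H) :
  inner H (x + y) z = (inner H x z + inner H y z).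
Proof. by rewrite linearDl. Qed.

Lemma innerDr (R : realType) (H : hilbertSpace R) (x y z : H) :
  inner H z (x + y) = (inner H z x + inner H z y).
Proof. by rewrite raddfD. Qed.

Lemma innerNl (R : realType) (H : hilbertSpace R) (x z : H) :
  inner H (- x) z = (- inner H x z).
Proof. by rewrite linearNl. Qed.

Lemma innerNr (R : realType) (H : hilbertSpace R) (x z : H) :
  inner H z (- x) = (- inner H z x).
Proof. by rewrite raddfN. Qed.

Lemma innerZl (R : realType) (H : hilbertSpace R) (a : R) (x z : H) :
  inner H (a *: x) z = (a * inner H x z).
Proof. by rewrite linearZl_LR. Qed.

Lemma innerZr (R : realType) (H : hilbertSpace R) (a : R) (x z : H) :
  inner H z (a *: x) = (a * inner H z x).
Proof. by rewrite inner_sym innerZl inner_sym. Qed.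

(** Polarization expresses the inner product by norms, whose continuity is
known; this avoids the Cauchy-Schwarz inequality. *)
Lemma inner_polarization (R : realType) (H : hilbertSpace R) (x y : H) :
  inner H x y = 2^-1 * (`|x + y| ^+ 2 - `|x| ^+ 2 - `|y| ^+ 2).
Proof.
rewrite !inner_norm innerDl !innerDr (inner_sym y x).
apply: (@mulfI _ 2); first by rewrite pnatr_eq0.
by rewrite mulVKf ?pnatr_eq0//; ring.
Qed.

Lemma cvg_inner (R : realType) (H : hilbertSpace R) (T : Type)
    (F : set_system T) (FF : Filter F) (f : T -> H) (x y : H) :
  f @ F --> x -> (fun t => inner H (f t) y) @ F --> inner H x y.
Proof.
move=> fx.
have sqr_cvg (g : T -> H) z : g @ F --> z ->
    (fun t => `|g t| ^+ 2 : R) @ F --> (`|z| ^+ 2 : R).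
  by move=> gz; rewrite expr2; apply: cvgM; exact: cvg_norm.
under eq_fun do rewrite inner_polarization.
rewrite inner_polarization; apply: cvgM; first exact: cvg_cst.
apply: cvgB; last exact: cvg_cst.
by apply: cvgB; apply: sqr_cvg => //; apply: cvgD => //; exact: cvg_cst.
Qed.

Lemma inner_extl (R : realType) (H : hilbertSpace R) (x y : H) :
  (forall z, inner H x z = inner H y z) -> x = y.
Proof.
move=> xy; apply/eqP; rewrite -subr_eq0 -normr_eq0 -sqrf_eq0 inner_norm.
by rewrite innerDl innerNl xy subrr.
Qed.

(** * Projections and reflections *)

Lemma partial_sumE (R : realType) (H : hilbertSpace R) (I : choiceType)
    (e : I -> H) (x : H) (J : {fset I}) :
  partial_sum (fun a => inner H x (e a) *: e a) J =
  \sum_(a <- J) inner H x (e a) *: e a.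
Proof. by rewrite /partial_sum big_seq_fsetE. Qed.

Lemma inner_partial_sum (R : realType) (H : hilbertSpace R) (I : choiceType)
    (e : I -> H) (x y : H) (J : {fset I}) :
  inner H (partial_sum (fun a => inner H x (e a) *: e a) J) y =
  \sum_(a <- J) inner H x (e a) * inner H y (e a).
Proof.
rewrite partial_sumE inner_sym raddf_sum; apply: eq_bigr => a _ /=.
by rewrite innerZr.
Qed.

(** This net describes [<P x, y>] by coefficients alone; limits along it replace
any algebra with the infinite sum [P x] itself. *)
Lemma cvg_inner_orth_proj (R : realType) (H : hilbertSpace R)
    (I : choiceType) (e : I -> H) (x y : H) : orthonormal_family e ->
  (fun J : {fset I} => \sum_(a <- J) inner H x (e a) * inner H y (e a))
    @ totally --> inner H (orth_proj e x) y.
Proof.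
move=> eo.
have -> : (fun J : {fset I} => \sum_(a <- J) inner H x (e a) * inner H y (e a))
    = fun J => inner H (partial_sum (fun a => inner H x (e a) *: e a) J) y.
  by apply/funext => J; rewrite inner_partial_sum.
have tF : ProperFilter (@totally I) by exact: totally_filter.
by apply: cvg_inner; exact: orth_proj_cvg.
Qed.

(** The sums converging to [<P x, y>] are symmetric in [x] and [y]. *)
Lemma orth_proj_sym (R : realType) (H : hilbertSpace R) (I : choiceType)
    (e : I -> H) (x y : H) : orthonormal_family e ->
  inner H (orth_proj e x) y = inner H x (orth_proj e y).
Proof.
move=> eo.
have tF : ProperFilter (@totally I) by exact: totally_filter.
have xy := cvg_inner_orth_proj _ _ _ _ x y eo.
have yx := cvg_inner_orth_proj _ _ _ _ y x eo.
rewrite [RHS]inner_sym; apply: (cvg_unique (@norm_hausdorff _ _) xy).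
suff -> : (fun J : {fset I} => \sum_(a <- J) inner H x (e a) * inner H y (e a))
    = fun J => \sum_(a <- J) inner H y (e a) * inner H x (e a) by exact: yx.
by apply/funext => J; apply: eq_bigr => a _; rewrite mulrC.
Qed.

(** The inner product with [e a] is constant along the partial sums that
contain the index [a]. *)
Lemma inner_orth_proj (R : realType) (H : hilbertSpace R) (I : choiceType)
    (e : I -> H) (x : H) (a : I) : orthonormal_family e ->
  inner H (orth_proj e x) (e a) = inner H x (e a).
Proof.
move=> eo.
have tF : ProperFilter (@totally I) by exact: totally_filter.
have xa := cvg_inner_orth_proj _ _ _ _ x (e a) eo.
apply: (cvg_unique (@norm_hausdorff _ _) xa); apply: cvg_near_cst.
exists [fset a]%fset => // J /= /fsubsetP aJ.
have {}aJ : a \in J by apply: aJ; rewrite inE.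
rewrite (big_fsetD1 a) //= eo.1 mulr1 big1_seq ?addr0//.
move=> b; rewrite !inE => /andP[_ /andP[ba _]].
by rewrite eo.2 ?mulr0// => ab; rewrite ab eqxx in ba.
Qed.

(** [L x] has the same coefficients along [e] as [x], hence the same projection
as [x]. *)
Lemma reflection_involutive (R : realType) (H : hilbertSpace R)
    (L : H -> H) : Refl H L -> involutive L.
Proof.
move=> [_ [I [e [eo LE]]]] x.
have same_proj : orth_proj e (L x) = orth_proj e x.
  congr sum; apply/funext => a; congr (_ *: _).
  by rewrite LE innerDl innerNl innerZl inner_orth_proj// mulr_natl mulr2n addrK.
by rewrite LE same_proj LE opprB addrC subrK.
Qed.

Lemma reflection_sym (R : realType) (H : hilbertSpace R) (L : H -> H)
    (x y : H) : Refl H L -> inner H (L x) y = inner H x (L y).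
Proof.
move=> [_ [I [e [eo LE]]]].
by rewrite !LE innerDl innerDr innerNl innerNr innerZl innerZr orth_proj_sym.
Qed.

Lemma reflection_orthogonal (R : realType) (H : hilbertSpace R) :
  Refl H `<=` orthogonal_maps H.
Proof.
move=> L RL; have LK := reflection_involutive _ _ _ RL.
split; [exact: RL.1.1|by exists L|].
by move=> x y; rewrite reflection_sym// LK.
Qed.

Lemma orthogonal_bounded (R : realType) (H : hilbertSpace R) :
  orthogonal_maps H `<=` bounded_operators H.
Proof.
move=> s [ls _ is_]; split=> //; exists 1 => x.
by rewrite mul1r -(@ler_pXn2r _ 2)// ?nnegrE// !inner_norm is_.
Qed.

(** Since [t] is the adjoint of [s], the coefficient of [x] along [s (e a)] is
that of [t x] along [e a], and similarly for a test vector [z]; so the inner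
products of the two sides with [z] are limits of the same sums. *)
Lemma orth_proj_conj (R : realType) (H : hilbertSpace R) (s t : H -> H)
    (I : choiceType) (e : I -> H) (x : H) :
  orthogonal_maps H s -> cancel s t -> cancel t s -> orthonormal_family e ->
  orth_proj (s \o e) x = s (orth_proj e (t x)).
Proof.
move=> [_ _ is_] st ts eo.
have seo : orthonormal_family (s \o e).
  by split=> [a|a b ab] /=; rewrite is_; [exact: eo.1|exact: eo.2].
have tF : ProperFilter (@totally I) by exact: totally_filter.
have adj u v : inner H u (s v) = inner H (t u) v by rewrite -[RHS]is_ ts.
apply: inner_extl => z; rewrite [RHS]inner_sym adj [RHS]inner_sym.
have xz := cvg_inner_orth_proj _ _ _ _ x z seo.
have tz := cvg_inner_orth_proj _ _ _ _ (t x) (t z) eo.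
apply: (cvg_unique (@norm_hausdorff _ _) xz).
suff -> : (fun J : {fset I} =>
      \sum_(a <- J) inner H x ((s \o e) a) * inner H z ((s \o e) a))
    = fun J => \sum_(a <- J) inner H (t x) (e a) * inner H (t z) (e a).
  exact: tz.
by apply/funext => J; apply: eq_bigr => a _; rewrite /= !adj.
Qed.

(** The conjugate of [2 P - I] by [s] is [2 (s P t) - I], and [s P t] is again a
projection attached to an orthonormal family, namely [s \o e]. *)
Lemma reflection_conj (R : realType) (H : hilbertSpace R)
    (s t L : H -> H) :
  orthogonal_maps H s -> cancel s t -> cancel t s -> Refl H L ->
  Refl H (s \o L \o t).
Proof.
move=> so st ts RL; split.
  (* [t] is the inverse of the orthogonal map [s], hence orthogonal itself. *)
  have [t' [t'o st' ts']] := orthogonal_maps_inv so.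
  have -> : t = t' by apply/funext => x; apply: (can_inj st'); rewrite ts ts'.
  apply: orthogonal_bounded; apply: orthogonal_maps_comp => //.
  by apply: orthogonal_maps_comp => //; exact: reflection_orthogonal.
case: RL => _ [I [e [eo LE]]]; exists I, (s \o e); split=> [|x].
  case: so => _ _ is_.
  by split=> [a|a b ab] /=; rewrite is_; [exact: eo.1|exact: eo.2].
rewrite (orth_proj_conj _ _ s t)//= LE.
have [ls _ _] := so.
have sD u v : s (u + v) = s u + s v by rewrite -[u in LHS]scale1r ls scale1r.
have s0 : s 0 = 0 by apply: (addrI (s 0)); rewrite -sD !addr0.
by rewrite ls -scaleN1r -[-1 *: t x]addr0 ls s0 addr0 scaleN1r ts.
Qed.

(** * Finite products of reflections *)

Lemma Theta_id (R : realType) (H : hilbertSpace R) : Theta H idfun.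
Proof.
split; first exact: orthogonal_bounded (orthogonal_maps_id H).
exists 0, (fun _ => idfun); split=> [[]//|].
by rewrite big_ord0.
Qed.

Lemma prod_reflections_orthogonal (R : realType) (H : hilbertSpace R) (m : nat)
    (L : 'I_m -> H -> H) :
  (forall j, Refl H (L j)) ->
  orthogonal_maps H (\big[@comp H H H/idfun]_(j < m) L j).
Proof.
move=> RL; apply: big_ind => [|s t|j _]; first exact: orthogonal_maps_id.
- exact: orthogonal_maps_comp.
- exact: reflection_orthogonal.
Qed.

Lemma Theta_orthogonal (R : realType) (H : hilbertSpace R) :
  Theta H `<=` orthogonal_maps H.
Proof. by move=> _ [_ [m [L [RL ->]]]]; exact: prod_reflections_orthogonal. Qed.

Lemma Theta_cons (R : realType) (H : hilbertSpace R) (L A : H -> H) :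
  Refl H L -> Theta H A -> Theta H (L \o A).
Proof.
move=> RL TA; split.
  apply: orthogonal_bounded; apply: orthogonal_maps_comp.
    exact: reflection_orthogonal.
  exact: Theta_orthogonal.
case: TA => _ [m [M [RM ->]]].
exists m.+1, (fun i => if unlift ord0 i is Some j then M j else L).
split=> [i|]; first by case: unlift.
rewrite big_ord_recl unlift_none; congr (_ \o _).
by apply: eq_bigr => i _; rewrite liftK.
Qed.

(** Closure properties of [Theta] follow from this principle without handling
indexed products and their bounds. *)
Lemma Theta_ind (R : realType) (H : hilbertSpace R) (P : (H -> H) -> Prop) :
  P idfun -> (forall L A, Refl H L -> P A -> P (L \o A)) ->
  forall A, Theta H A -> P A.
Proof.
move=> P1 PS _ [_ [m [L [RL ->]]]]; elim: m L RL => [|m IH] L RL.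
  by rewrite big_ord0.
by rewrite big_ord_recl; apply: PS => //; exact: IH.
Qed.

Lemma Theta_comp (R : realType) (H : hilbertSpace R) (A B : H -> H) :
  Theta H A -> Theta H B -> Theta H (A \o B).
Proof.
move=> TA TB; move: A TA; apply: Theta_ind => // L A RL TAB.
exact: (Theta_cons _ _ L (A \o B)).
Qed.

Lemma Refl_Theta (R : realType) (H : hilbertSpace R) : Refl H `<=` Theta H.
Proof. by move=> L RL; exact: (Theta_cons _ _ L idfun RL (Theta_id _ H)). Qed.

(** Reversing the order of the factors inverts a product of involutions. *)
Lemma Theta_inverse (R : realType) (H : hilbertSpace R) (A : H -> H) :
  Theta H A -> exists2 B, Theta H B & cancel B A.
Proof.
move: A; apply: Theta_ind => [|L A RL [B TB BA]].
  by exists idfun => //; exact: Theta_id.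
exists (B \o L); first by apply: Theta_comp => //; exact: Refl_Theta.
by move=> x /=; rewrite BA (reflection_involutive _ _ _ RL).
Qed.

Lemma Theta_conj (R : realType) (H : hilbertSpace R) (s t A : H -> H) :
  orthogonal_maps H s -> cancel s t -> cancel t s ->
  Theta H A -> Theta H (s \o A \o t).
Proof.
move=> so st ts; move: A; apply: Theta_ind => [|L A RL TsAt].
  have -> : s \o idfun \o t = idfun by apply/funext.
  exact: Theta_id.
have -> : s \o (L \o A) \o t = (s \o L \o t) \o (s \o A \o t).
  by apply/funext => x /=; rewrite st.
by apply: Theta_cons => //; exact: reflection_conj.
Qed.

Local Close Scope ring_scope.

Theorem theorem3p9 (R : realType) (K : choiceType) (H : hilbertSpace R) :
  has_hilbert_dim H K ->
  Theta H `<=` orthogonal_maps H /\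
  normal_subgroup [set s : orthogonal_group H | Theta H (val s)].
Proof.
move=> _; split; first exact: Theta_orthogonal.
split; [split|].
- by rewrite inE /=; exact: Theta_id.
- move=> x y; rewrite !inE /= => Tx Ty.
  have [B TB BK] := Theta_inverse _ _ _ Ty.
  have yB : B = val (ogroup_inv y).
    by apply/funext => z; rewrite -[in RHS](BK z) (ogroup_invK y).1.
  by apply: (Theta_comp _ _ (val x) (val (ogroup_inv y))) => //; rewrite -yB.
- move=> x y /= Tx.
  have [yK Ky] := ogroup_invK y.
  exact: (Theta_conj _ _ (val (ogroup_inv y)) (val y) _
    (orthogonal_groupP _) Ky yK Tx).
Qed.
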